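(* Let $G$ be a finite simple graph with vertex set $V(G)$ and edge set $E(G)$, let $R$ be a nontrivial commutative ring, and let $\omega: E(G)\to R\setminus\{0\}$ be an edge weight. Let $\eta$ be a proper embedding of $G$ in the plane. Then for every proper embedding $\eta'$ of $G$ there is a sign-modification $\omega'$ of $\omega$ such that $$ s(G,\omega,\eta) = s(G,\omega',\eta'). $$
   Context: An embedding of a finite graph $G$ in $\mathbb{R}^2$ assigns to each vertex a distinct point (vertex-point) and to each edge $e=\{v_1,v_2\}$ a smooth curve $[0,1]\to\mathbb{R}^2$ (edge-curve) from the point of $v_1$ to the point of $v_2$ which does not pass twice through the same point and does not pass through any other vertex-point. The embedding is proper if, in addition, any two edge-curves meeting in a point that is not a vertex-point actually cross there (are not tangent there), and there are only finitely many such crossing points. A perfect matching of $G$ is a set $M\subseteq E(G)$ of edges such that every vertex is incident with exactly one edge of $M$. Its weight is $\omega(M)=\prod_{e\in M}\omega(e)$. For a proper embedding $\eta$, let $C(M,\eta)=\sum_{\{e_1,e_2\}\subseteq M}\left|\mathrm{img}(e_1)\cap\mathrm{img}(e_2)\right|$, where the sum is over unordered pairs of distinct edges of $M$ and $\mathrm{img}(e)$ is the image of the edge-curve of $e$ under $\eta$; the sign of $M$ is $\mathrm{sgn}(M,\eta)=(-1)^{C(M,\eta)}$. The signed generating function of perfect matchings is $s(G,\omega,\eta)=\sum_M \mathrm{sgn}(M,\eta)\,\omega(M)$, the sum over all perfect matchings $M$ of $G$. An edge weight $\omega'$ is a sign-modification of $\omega$ if for every $e\in E(G)$ either $\omega'(e)=\omega(e)$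 or $\omega'(e)=-\omega(e)$. *)

(* Defs.v *)
From Stdlib Require Import Reals ClassicalEpsilon.
From Stdlib Require List.
From HB Require Import structures.
From mathcomp Require Import all_boot all_algebra.

Set Implicit Arguments.
Unset Strict Implicit.
Unset Printing Implicit Defensive.

Import GRing.Theory.

Definition point : Type := (R * R)%type.

Definition in01 (t : R) : Prop := Rle 0 t /\ Rle t 1.

Section Graph.
Variable V : finType.
Variable adj : rel V.

Definition simple_graph : Prop := symmetric adj /\ irreflexive adj.

Definition is_edge (e : {set V}) : bool :=
  [exists u, exists v, adj u v && (e == [set u; v])].

Definition perfect_matching (M : {set {set V}}) : bool :=
  (M \subset [set e | is_edge e]) &&
  [forall v, #|[set e in M | v \in e]| == 1%N].

(* An (attempted) drawing: a point for every vertex, and for every edge a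
   map R -> R^2 together with the tower of all its derivatives
   (tower e 0 is the curve itself, tower e 1 its derivative, ...).
   Only the restriction to [0,1] is the edge-curve. *)
Record embedding := Embedding {
  vpos : V -> point;
  tower : {set V} -> nat -> R -> point
}.

Definition ecurve (eta : embedding) (e : {set V}) : R -> point := tower eta e 0.

Definition img (eta : embedding) (e : {set V}) (p : point) : Prop :=
  exists t, in01 t /\ ecurve eta e t = p.

Definition is_vertex_point (eta : embedding) (p : point) : Prop :=
  exists v, vpos eta v = p.

Definition smooth_tower (f : nat -> R -> point) : Prop :=
  forall (n : nat) (x : R),
    derivable_pt_lim (fun t => fst (f n t)) x (fst (f n.+1 x)) /\
    derivable_pt_lim (fun t => snd (f n t)) x (snd (f n.+1 x)).

Definition is_embedding (eta : embedding) : Prop :=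
  injective (vpos eta) /\
  forall e, is_edge e ->
    smooth_tower (tower eta e) /\
    (exists u v, e = [set u; v] /\
       ecurve eta e R0 = vpos eta u /\ ecurve eta e R1 = vpos eta v) /\
    (forall s t, in01 s -> in01 t -> ecurve eta e s = ecurve eta e t -> s = t) /\
    (forall w t, w \notin e -> in01 t -> ecurve eta e t <> vpos eta w).

Definition proper_embedding (eta : embedding) : Prop :=
  is_embedding eta /\
  (forall e1 e2 s t, is_edge e1 -> is_edge e2 -> e1 != e2 ->
     in01 s -> in01 t -> ecurve eta e1 s = ecurve eta e2 t ->
     ~ is_vertex_point eta (ecurve eta e1 s) ->
     let d1 := tower eta e1 1 s in let d2 := tower eta e2 1 t in
     Rminus (Rmult (fst d1) (snd d2)) (Rmult (snd d1) (fst d2)) <> R0) /\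
  (exists l : list point, forall p,
     (exists e1 e2, is_edge e1 /\ is_edge e2 /\ e1 != e2 /\
        img eta e1 p /\ img eta e2 p) ->
     ~ is_vertex_point eta p -> List.In p l).

Definition ncross (eta : embedding) (e1 e2 : {set V}) : nat :=
  epsilon (inhabits 0%N) (fun n => exists l : list point,
     List.NoDup l /\ List.length l = n /\
     forall p, List.In p l <-> (img eta e1 p /\ img eta e2 p)).

Definition Ccross (eta : embedding) (M : {set {set V}}) : nat :=
  \sum_(e1 in M) \sum_(e2 in M | (enum_rank e1 < enum_rank e2)%N)
      ncross eta e1 e2.

Local Open Scope ring_scope.

Definition sgf (A : comNzRingType) (omega : {set V} -> A) (eta : embedding) : A :=
  \sum_(M : {set {set V}} | perfect_matching M)
     ((-1) ^+ Ccross eta M * \prod_(e in M) omega e).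

Definition sign_modification (A : comNzRingType) (omega omega' : {set V} -> A)
  : Prop :=
  forall e, is_edge e -> omega' e = omega e \/ omega' e = - omega e.

End Graph.

(* Main.v *)
(** For disjoint edges [e] from [a] to [b] and [f] from [c] to [d], the crossings
    are the zeros of [(s, t) |-> e s - f t] on the unit square.  None lies on the
    boundary and transversality makes each of them nondegenerate, so their number
    has the parity of the winding number of this map along the boundary, that is of
    [(th_e c + th_f b - th_e d - th_f a) / 2 pi], where [th_e y] is the angle
    swept by [e] seen from [y].  Writing [th_e y] as
    [arg (b - y) - arg (a - y) + 2 pi k_e y], and using that [arg (y - x)] and
    [arg (x - y)] differ by [pi] modulo [2 pi], this parity becomes the parity of
    the crossings of two chords between linearly ordered vertices, plus
    [sum_(y in f) h_e y + sum_(x in e) h_f x] for some [h].  Summed over the pairs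
    of edges of a perfect matching, the chord term does not depend on the embedding,
    while the rest is [sum_(e in M) sum_(y notin e) h_e y]: it is absorbed by
    changing the sign of the weight of each edge separately. *)

Require Import Defs.
From Stdlib Require Import Reals ZArith Lra Lia ClassicalEpsilon.
From Coquelicot Require Import Coquelicot.
From HB Require Import structures.
From mathcomp Require Import all_boot all_algebra.

Set Implicit Arguments.
Unset Strict Implicit.
Unset Printing Implicit Defensive.

Lemma big_set2 (V : finType) (R : Type) (idx : R) (op : Monoid.com_law idx) (u v : V) (F : V -> R) :
  u != v -> \big[op/idx]_(x in [set u; v]) F x = op (F u) (F v).
Proof. by move=> uv; rewrite big_setU1 ?inE // big_set1. Qed.

Lemma Zodd_nat n : Z.odd (Z.of_nat n) = odd n.
Proof.
elim: n => // n IH.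
by rewrite Nat2Z.inj_succ Z.odd_succ -Z.negb_odd IH.
Qed.

Section Winding.
Local Open Scope R_scope.
Local Obligation Tactic := idtac.

(** * Rotations up to positive scaling, and angles between plane vectors *)

Definition psub (p q : point) : point := (fst p - fst q, snd p - snd q).
Definition popp (p : point) : point := (- fst p, - snd p).
Definition dot (p q : point) : R := fst p * fst q + snd p * snd q.
Definition cross (p q : point) : R := fst p * snd q - snd p * fst q.

(** The free factor [l] forgets lengths, so angles add under composition, and for nonzero [p] the
    angle is determined modulo 2 pi. *)
Definition rotp (a : R) (p q : point) : Prop :=
  exists2 l, 0 < l &
    fst q = l * (cos a * fst p - sin a * snd p) /\
    snd q = l * (sin a * fst p + cos a * snd p).

(* The oriented angle from [p] to [q], meaningful only when [0 < dot p q]. *)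
Definition rang (p q : point) : R := atan (cross p q / dot p q).

Lemma dot_gt0 (p : point) : p <> (0, 0) -> 0 < dot p p.
Proof.
case: p => x y /= Hp; rewrite /dot /=.
have [Hx|Hx] := Req_dec x 0; last by nra.
have [Hy|Hy] := Req_dec y 0; last by nra.
by case: Hp; rewrite Hx Hy.
Qed.

Lemma dot_pos_l (p q : point) : 0 < dot p q -> 0 < dot p p.
Proof.
by move=> H; apply: dot_gt0 => Hp; move: H; rewrite Hp /dot /=; lra.
Qed.

Lemma dotC (p q : point) : dot p q = dot q p.
Proof. by rewrite /dot; ring. Qed.

Lemma dot_pos_r (p q : point) : 0 < dot p q -> 0 < dot q q.
Proof. by rewrite dotC; apply: dot_pos_l. Qed.

Lemma rotp_trans a b (p q r : point) :
  rotp a p q -> rotp b q r -> rotp (a + b) p r.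
Proof.
move=> [l Hl [H1 H2]] [m Hm [H3 H4]]; exists (l * m); first nra.
rewrite H3 H4 H1 H2 cos_plus sin_plus; split; ring.
Qed.

Lemma rotp_opp a (p q : point) : rotp a p q -> rotp a (popp p) (popp q).
Proof.
move=> [l Hl [H1 H2]]; exists l => //; rewrite /= H1 H2; split; ring.
Qed.

Lemma rotp_pi a (p q : point) : rotp a p q -> rotp (a + PI) p (popp q).
Proof.
move=> [l Hl [H1 H2]]; exists l => //; rewrite /= H1 H2.
rewrite neg_cos neg_sin; split; ring.
Qed.

Lemma rotp_sym a (p q : point) : rotp a p q -> rotp (- a) q p.
Proof.
move=> [l Hl [H1 H2]]; exists (/ l); first exact: Rinv_0_lt_compat.
have H := sin2_cos2 a; rewrite /Rsqr in H.
rewrite H1 H2 cos_neg sin_neg; split.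
  transitivity ((sin a * sin a + cos a * cos a) * fst p); last by field; lra.
  by rewrite H; ring.
transitivity ((sin a * sin a + cos a * cos a) * snd p); last by field; lra.
by rewrite H; ring.
Qed.

Lemma sin0_cos_gt0_2PI a : sin a = 0 -> 0 < cos a -> exists k : Z, a = 2 * PI * IZR k.
Proof.
move=> Hs Hc; have [k Hk] := sin_eq_0_0 a Hs.
have [[j Hj]|[j Hj]] : (exists j, k = Z.mul 2 j) \/ (exists j, k = Z.add (Z.mul 2 j) 1).
- have [H|H] := Zeven.Zeven_odd_dec k.
    by left; exists (Z.div2 k); apply: Zeven.Zeven_div2.
  by right; exists (Z.div2 k); apply: Zeven.Zodd_div2.
- by exists j; rewrite Hk Hj mult_IZR; ring.
- exfalso; move: Hc; rewrite Hk Hj plus_IZR mult_IZR.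
  have -> : (2 * IZR j + 1) * PI = PI + 2 * IZR j * PI by ring.
  rewrite Rtrigo_facts.cos_pi_plus.
  have H1 : cos (2 * IZR j * PI) = 1.
    rewrite (_ : 2 * IZR j * PI = 2 * (IZR j * PI)); last ring.
    rewrite cos_2a_sin (_ : sin (IZR j * PI) = 0); first ring.
    by apply: sin_eq_0_1; exists j.
  lra.
Qed.

(** Rotating by [a] and back by [b] maps [p] to itself up to the factor [l]. Projecting on [p] and
    on its normal gives [E1] and [E2]: the sine of [a - b] vanishes and its cosine is positive. *)
Lemma rotp_unique a b (p q : point) : 0 < dot p p ->
  rotp a p q -> rotp b p q -> exists k : Z, a = b + 2 * PI * IZR k.
Proof.
move=> Hp Ha /rotp_sym Hb.
have [l Hl [H1 H2]] := rotp_trans Ha Hb.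
have [k Hk] : exists k : Z, a + - b = 2 * PI * IZR k; last first.
  by exists k; lra.
have E1 : l * cos (a + - b) * dot p p = dot p p.
  rewrite {2}/dot {2}H1 {2}H2 /dot; ring.
have E2 : l * sin (a + - b) * dot p p = 0.
  transitivity (fst p * snd p - snd p * fst p); last ring.
  rewrite {2}H1 {1}H2 /dot; ring.
apply: sin0_cos_gt0_2PI.
  have : (l * dot p p) * sin (a + - b) = 0 by lra.
  by case/Rmult_integral => //; nra.
have [//|H] := Rlt_or_le 0 (cos (a + - b)).
have : 0 < l * dot p p by nra.
nra.
Qed.

Lemma cos_atan_pos t : 0 < cos (atan t).
Proof. by have [H1 H2] := atan_bound t; apply: cos_gt_0; lra. Qed.

Lemma rotp_rang (p q : point) : 0 < dot p q -> rotp (rang p q) p q.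
Proof.
move=> H; have Hp := dot_pos_l H.
have Hc := cos_atan_pos (cross p q / dot p q).
rewrite -/(rang p q) in Hc *.
have Ht : sin (rang p q) = cross p q / dot p q * cos (rang p q).
  rewrite -{1}(tan_atan (cross p q / dot p q)) -/(rang p q) /tan; field; lra.
(* This is the ratio of the lengths of [q] and [p], since [dot p q] is the product of both lengths
   and the cosine. *)
exists (dot p q / (cos (rang p q) * dot p p)).
  by apply: Rdiv_lt_0_compat => //; nra.
rewrite Ht; split.
  transitivity ((dot p q * fst p - cross p q * snd p) / dot p p); last by field; lra.
  by rewrite /cross /dot in Hp *; field; lra.
transitivity ((cross p q * fst p + dot p q * snd p) / dot p p); last by field; lra.
by rewrite /cross /dot in Hp *; field; lra.
Qed.

Lemma arg_exists (p : point) : 0 < dot p p -> exists a, rotp a (1, 0) p.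
Proof.
move=> Hp; have [H|[H|H]] := Rtotal_order (fst p) 0.
- have /rotp_rang /rotp_pi : 0 < dot (1, 0) (popp p) by rewrite /dot /=; lra.
  have -> : popp (popp p) = p by case: p {Hp H} => x y; rewrite /popp /= !Ropp_involutive.
  by move=> ?; eexists; eassumption.
- have [H2|[H2|H2]] := Rtotal_order (snd p) 0.
  + exists (- (PI / 2)), (- snd p); first lra.
    by rewrite cos_neg sin_neg cos_PI2 sin_PI2 /=; lra.
  + by move: Hp; rewrite /dot H H2; lra.
  + exists (PI / 2), (snd p); first lra.
    by rewrite cos_PI2 sin_PI2 /=; lra.
- by exists (rang (1, 0) p); apply: rotp_rang; rewrite /dot /=; lra.
Qed.

(** * Continuously differentiable curves and the angle they sweep around the origin *)

Record curve := Curve {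
  cx : R -> R;
  cy : R -> R;
  dcx : R -> R;
  dcy : R -> R;
  derx : forall t, is_derive cx t (dcx t);
  dery : forall t, is_derive cy t (dcy t);
  contx : forall t, continuous dcx t;
  conty : forall t, continuous dcy t
}.

Definition pos (g : curve) (t : R) : point := (cx g t, cy g t).
Definition vel (g : curve) (t : R) : point := (dcx g t, dcy g t).
Coercion pos : curve >-> Funclass.

Lemma Derive_cx (g : curve) t : Derive (fun x => cx g x) t = dcx g t.
Proof. exact/is_derive_unique/derx. Qed.

Lemma Derive_cy (g : curve) t : Derive (fun x => cy g x) t = dcy g t.
Proof. exact/is_derive_unique/dery. Qed.

Lemma ex_derive_cx (g : curve) t : ex_derive (fun x => cx g x) t.
Proof. by eexists; apply: derx. Qed.

Lemma ex_derive_cy (g : curve) t : ex_derive (fun x => cy g x) t.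
Proof. by eexists; apply: dery. Qed.

Lemma continuous_cx (g : curve) t : continuous (cx g) t.
Proof. exact/ex_derive_continuous/ex_derive_cx. Qed.

Lemma continuous_cy (g : curve) t : continuous (cy g) t.
Proof. exact/ex_derive_continuous/ex_derive_cy. Qed.

(** Applied with [c = u = -1] and [v = 2 * s]: time is reversed about [s] and the vector from [p] to
    the curve is negated. *)
Program Definition affine (c u v : R) (p : point) (g : curve) : curve :=
  @Curve (fun t => c * (cx g (u * t + v) - fst p)) (fun t => c * (cy g (u * t + v) - snd p))
         (fun t => c * u * dcx g (u * t + v)) (fun t => c * u * dcy g (u * t + v))
         _ _ _ _.
Next Obligation.
move=> c u v p g t /=.
auto_derive; last by rewrite Derive_cx; ring.
exact: ex_derive_cx.
Qed.
Next Obligation.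
move=> c u v p g t /=.
auto_derive; last by rewrite Derive_cy; ring.
exact: ex_derive_cy.
Qed.
Next Obligation.
move=> c u v p g t /=.
apply: (continuous_mult (fun _ => c * u)); first exact: continuous_const.
apply: (continuous_comp (fun t => u * t + v) (dcx g)); last exact: contx.
by apply: ex_derive_continuous; auto_derive.
Qed.
Next Obligation.
move=> c u v p g t /=.
apply: (continuous_mult (fun _ => c * u)); first exact: continuous_const.
apply: (continuous_comp (fun t => u * t + v) (dcy g)); last exact: conty.
by apply: ex_derive_continuous; auto_derive.
Qed.

Program Definition shift (g : curve) (p : point) : curve :=
  @Curve (fun t => cx g t - fst p) (fun t => cy g t - snd p) (dcx g) (dcy g) 
    _ _ (@contx g) (@conty g).
Next Obligation.
move=> g p t /=.
auto_derive; last by rewrite Derive_cx; ring.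
exact: ex_derive_cx.
Qed.
Next Obligation.
move=> g p t /=.
auto_derive; last by rewrite Derive_cy; ring.
exact: ex_derive_cy.
Qed.

Program Definition cst (p : point) : curve :=
  @Curve (fun _ => fst p) (fun _ => snd p) (fun _ => 0) (fun _ => 0) _ _ _ _.
Next Obligation. by move=> p t /=; apply: is_derive_const. Qed.
Next Obligation. by move=> p t /=; apply: is_derive_const. Qed.
Next Obligation. by move=> p t /=; apply: continuous_const. Qed.
Next Obligation. by move=> p t /=; apply: continuous_const. Qed.

(** The derivative of the polar angle along [g]. Integrating it gives a continuous angle without
    choosing a branch. *)
Definition dangle (g : curve) (t : R) : R := cross (g t) (vel g t) / dot (g t) (g t).

Definition ang (g : curve) (a b : R) : R := RInt (dangle g) a b.

Lemma dangle_cont (g : curve) t : 0 < dot (g t) (g t) -> continuous (dangle g) t.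
Proof.
move=> H; rewrite /dangle /Rdiv /cross /=.
have ctx := @continuous_cx g t; have cty := @continuous_cy g t.
have ctx' := @contx g t; have cty' := @conty g t.
apply: (continuous_mult (fun t => cx g t * dcy g t - cy g t * dcx g t)).
  apply: (continuous_minus (fun t => cx g t * dcy g t));
  exact: continuous_mult.
apply: continuous_Rinv_comp; last lra.
by apply: (continuous_plus (fun t => cx g t * cx g t)); apply: continuous_mult.
Qed.

Lemma ex_RInt_dangle (g : curve) a b : a <= b ->
  (forall t, a <= t <= b -> 0 < dot (g t) (g t)) -> ex_RInt (dangle g) a b.
Proof.
move=> ab H; apply: ex_RInt_continuous => t.
by rewrite Rmin_left // Rmax_right // => /H /dangle_cont.
Qed.

Lemma ang_Chasles (g : curve) a b c : a <= b -> b <= c ->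
  (forall t, a <= t <= c -> 0 < dot (g t) (g t)) ->
  ang g a b + ang g b c = ang g a c.
Proof.
move=> ab bc H; apply: (RInt_Chasles (dangle g));
  by apply: ex_RInt_dangle => // t Ht; apply: H; lra.
Qed.

(** The derivative of [rang (g t) (h t)] is [dangle h t - dangle g t]. Positivity of the dot product
    keeps the angle between the curves within a quarter turn, so the arctangent does not jump. *)
Lemma ang_compare (g h : curve) a b : a <= b ->
  (forall t, a <= t <= b -> 0 < dot (g t) (h t)) ->
  ang h a b - ang g a b = rang (g b) (h b) - rang (g a) (h a).
Proof.
move=> ab H.
have Hg t : a <= t <= b -> 0 < dot (g t) (g t) by move/H/dot_pos_l.
have Hh t : a <= t <= b -> 0 < dot (h t) (h t) by move/H/dot_pos_r.
change (ang h a b - ang g a b) with (minus (RInt (dangle h) a b) (RInt (dangle g) a b)).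
rewrite -RInt_minus; try exact: ex_RInt_dangle.
apply: is_RInt_unique.
apply: (is_RInt_derive (fun t => rang (g t) (h t))); rewrite Rmin_left // Rmax_right // => t Ht; last first.
  by apply: (continuous_minus (dangle h)); apply: dangle_cont; auto.
have Ht0 := H t Ht; have Hg0 := Hg t Ht; have Hh0 := Hh t Ht.
rewrite /rang /cross; move: Ht0 Hg0 Hh0.
rewrite /dangle /minus /plus /Hierarchy.opp /= /cross /dot /= => Ht0 Hg0 Hh0.
auto_derive.
  do ?split; try exact: ex_derive_cx; try exact: ex_derive_cy; lra.
rewrite !Derive_cx !Derive_cy.
field; do ?split; try lra.
have := Rle_0_sqr (cx g t * cy h t - cy g t * cx h t).
have : 0 < (cx g t * cx h t + cy g t * cy h t) * (cx g t * cx h t + cy g t * cy h t) by nra.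
rewrite /Rsqr; nra.
Qed.

Lemma ang_cst p a b : ang (cst p) a b = 0.
Proof.
rewrite /ang (RInt_ext _ (fun _ => 0)); first by rewrite RInt_const /scal /= /mult /=; ring.
by move=> t _; rewrite /dangle /cross /= /Rdiv; ring.
Qed.

Lemma ang_local (g : curve) p a b : a <= b ->
  (forall t, a <= t <= b -> 0 < dot p (g t)) ->
  ang g a b = rang p (g b) - rang p (g a).
Proof. by move=> ab H; rewrite -(@ang_compare (cst p)) //= ang_cst; lra. Qed.


(** Compactness of the interval in the form of an induction: a property of intervals that is
    preserved by gluing and holds near each point holds globally. The proof takes the supremum of
    the endpoints reached from [a]. *)
Lemma cousin (P : R -> R -> Prop) a b : a <= b ->
  (forall u v w, a <= u -> u <= v -> v <= w -> w <= b -> P u v -> P v w -> P u w) ->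
  (forall x, a <= x <= b -> exists2 d, 0 < d &
     forall u v, a <= u -> u <= x -> x <= v -> v <= b -> v - u < d -> P u v) ->
  P a b.
Proof.
move=> ab Padd Ploc.
pose E y := a <= y <= b /\ P a y.
have Ea : E a.
  split; first lra.
  by have [|d d0 Hd] := Ploc a; [lra | apply: Hd; lra].
have [||m [mub mlub]] := completeness E; last 1 first.
- have am : a <= m by apply: mub.
  have mb : m <= b by apply: mlub => y [? _]; lra.
  have [|d d0 Hd] := Ploc m; first lra.
  have [y [[yab Py] my]] : exists y, E y /\ m - d / 3 < y.
    apply: Classical_Prop.NNPP => H.
    have : m <= m - d / 3; last lra.
    apply: mlub => y Ey; apply: Rnot_lt_le => my; apply: H; exists y; split => //; lra.
  have ym : y <= m by apply: mub.
  have [v1 v2] : Rmin (m + d / 3) b <= m + d / 3 /\ Rmin (m + d / 3) b <= b.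
    by split; [exact: Rmin_l | exact: Rmin_r].
  have v3 : m <= Rmin (m + d / 3) b by apply: Rmin_glb; lra.
  have Pv : P a (Rmin (m + d / 3) b).
    by apply: (Padd _ y) => //; try lra; apply: Hd; lra.
  (* The property has been pushed past [m], up to [m + d / 3] or to [b]; maximality of [m] leaves
     only [b]. *)
  have : Rmin (m + d / 3) b <= m by apply: mub; split => //; lra.
  by move: Pv; rewrite /Rmin; case: Rle_dec => // *; lra.
- by exists b => y [? _]; lra.
- by exists a.
Qed.

Lemma continuous_near (f : R -> R) x eps : continuous f x -> 0 < eps ->
  exists2 d, 0 < d & forall t, Rabs (t - x) < d -> Rabs (f t - f x) < eps.
Proof.
move=> Hf He.
have [d Hd] := proj1 (filterlim_locally f (f x)) Hf (mkposreal eps He).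
by exists d; [exact: cond_pos | move=> t Ht; apply: Hd].
Qed.

Lemma dot_near (g : curve) p x eps : 0 < eps ->
  exists2 d, 0 < d &
    forall t, Rabs (t - x) < d -> Rabs (dot p (g t) - dot p (g x)) < eps.
Proof.
apply: (@continuous_near (fun t => dot p (g t))).
apply: (continuous_plus (fun t => fst p * cx g t)); apply: continuous_mult;
  by [exact: continuous_const | exact: continuous_cx | exact: continuous_cy].
Qed.

(** On a short interval [g] stays in an open half plane, where the swept angle is a difference of
    two values of [rang]. [cousin] glues the short intervals, since both the angle and [rotp] are
    additive. *)
Lemma ang_rotp (g : curve) a b : a <= b ->
  (forall t, a <= t <= b -> 0 < dot (g t) (g t)) -> rotp (ang g a b) (g a) (g b).
Proof.
move=> ab H; apply: (@cousin (fun u v => rotp (ang g u v) (g u) (g v))) => //.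
  move=> u v w ? ? ? ? H1 H2; rewrite -(@ang_Chasles g u v w) //; last first.
    by move=> t Ht; apply: H; lra.
  exact: rotp_trans H1 H2.
move=> x Hx; have [d d0 Hd] := dot_near g (g x) x (H x Hx).
exists d => // u v au ux xv vb vud.
have Hp t : u <= t <= v -> 0 < dot (g x) (g t).
  move=> Ht; have /Hd : Rabs (t - x) < d by apply: Rabs_def1; lra.
  by case/Rabs_def2; lra.
rewrite (@ang_local g (g x)) //; last lra.
rewrite /Rminus Rplus_comm; apply: (@rotp_trans _ _ _ (g x)).
  by apply/rotp_sym/rotp_rang/Hp; lra.
by apply/rotp_rang/Hp; lra.
Qed.

(** * Winding of [e s - f t] along the boundary of a rectangle *)

Lemma shiftE (g : curve) p t : shift g p t = psub (g t) p.
Proof. by []. Qed.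

Lemma shift_neq0 (g : curve) p t : g t <> p -> 0 < dot (shift g p t) (shift g p t).
Proof.
move=> H; apply: dot_gt0 => E; apply: H.
case: p E => x y; rewrite /pos /= => -[H1 H2]; congr pair; lra.
Qed.

(* The angle swept by [e s - f t] along the boundary of [[s1, s2] x [t1, t2]]; on
   the vertical sides, [f t - e s] sweeps the same angle. *)
Definition wind (e f : curve) (s1 s2 t1 t2 : R) : R :=
  ang (shift e (f t1)) s1 s2 + ang (shift f (e s2)) t1 t2
  - ang (shift e (f t2)) s1 s2 - ang (shift f (e s1)) t1 t2.

Lemma wind_split_s (e f : curve) s1 s2 s3 t1 t2 : s1 <= s2 -> s2 <= s3 ->
  (forall s, s1 <= s <= s3 -> e s <> f t1 /\ e s <> f t2) ->
  wind e f s1 s3 t1 t2 = wind e f s1 s2 t1 t2 + wind e f s2 s3 t1 t2.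
Proof.
move=> s12 s23 H; rewrite /wind.
rewrite -!(@ang_Chasles (shift e _) s1 s2 s3) //; first ring;
  by move=> s /H [? ?]; apply: shift_neq0.
Qed.

Lemma wind_split_t (e f : curve) s1 s2 t1 t2 t3 : t1 <= t2 -> t2 <= t3 ->
  (forall t, t1 <= t <= t3 -> e s1 <> f t /\ e s2 <> f t) ->
  wind e f s1 s2 t1 t3 = wind e f s1 s2 t1 t2 + wind e f s1 s2 t2 t3.
Proof.
move=> t12 t23 H; rewrite /wind.
rewrite -!(@ang_Chasles (shift f _) t1 t2 t3) //; first ring;
  by move=> s /H [? ?]; apply: shift_neq0; apply: not_eq_sym.
Qed.

Lemma rang_oppl (p q : point) : rang (popp p) q = rang p (popp q).
Proof. by rewrite /rang /cross /dot /=; congr (atan (_ / _)); ring. Qed.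

Lemma rang_opp2 (p q : point) : rang (popp p) (popp q) = rang p q.
Proof. by rewrite /rang /cross /dot /=; congr (atan (_ / _)); ring. Qed.

Lemma rang_swap (p q : point) : rang q p = - rang p q.
Proof.
rewrite /rang -atan_opp /Rdiv Ropp_mult_distr_l dotC; congr (atan (_ / _)).
by rewrite /cross; ring.
Qed.

Lemma psub_opp (p q : point) : psub p q = popp (psub q p).
Proof. by rewrite /psub /popp /=; congr pair; ring. Qed.

(** If [e s - f t] stays in a half plane, every side contributes the difference of [rang p] at its
    two corners, and these cancel around the boundary. *)
Lemma wind_local (e f : curve) s1 s2 t1 t2 p : s1 <= s2 -> t1 <= t2 ->
  (forall s t, s1 <= s <= s2 -> t1 <= t <= t2 -> 0 < dot p (psub (e s) (f t))) ->
  wind e f s1 s2 t1 t2 = 0.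
Proof.
move=> s12 t12 H; rewrite /wind.
rewrite !(@ang_local (shift e _) p) //; last 2 first.
- by move=> s Hs; apply: H => //; lra.
- by move=> s Hs; apply: H => //; lra.
have dot2 q r : dot (popp q) (popp r) = dot q r by rewrite /dot /=; ring.
rewrite !(@ang_local (shift f _) (popp p)) //; last 2 first.
- by move=> t Ht; rewrite shiftE psub_opp dot2; apply: H => //; lra.
- by move=> t Ht; rewrite shiftE psub_opp dot2; apply: H => //; lra.
rewrite !shiftE !(psub_opp (f _)) !rang_opp2; ring.
Qed.

(** Winding is additive under subdivision in each parameter, so [cousin], applied in [s] and then in
    [t], reduces the claim to small rectangles. There continuity keeps the nonzero vector
    [e s - f t] in a half plane. *)
Lemma wind_free (e f : curve) s1 s2 t1 t2 : s1 <= s2 -> t1 <= t2 ->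
  (forall s t, s1 <= s <= s2 -> t1 <= t <= t2 -> e s <> f t) ->
  wind e f s1 s2 t1 t2 = 0.
Proof.
move=> s12 t12 H.
apply: (@cousin (fun u v => wind e f u v t1 t2 = 0)) => //.
  move=> u v w ? ? ? ? H1 H2; rewrite (@wind_split_s _ _ _ v) // ?H1 ?H2; first ring.
  by move=> s Hs; split; apply: H; lra.
move=> x Hx.
(* How thin a strip around [x] must be may depend on [t] and [t']; gluing two intervals takes the
   minimum of the two widths. *)
pose P t t' := exists2 d, 0 < d & forall u v,
  s1 <= u -> u <= x -> x <= v -> v <= s2 -> v - u < d -> wind e f u v t t' = 0.
apply: (@cousin P) => // [t t' t'' ? ? ? ? [d d0 Hd] [d' d'0 Hd']|y Hy].
  exists (Rmin d d'); first exact: Rmin_pos.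
  move=> u v ? ? ? ? Huv; have ? := Rmin_l d d'; have ? := Rmin_r d d'.
  rewrite (@wind_split_t _ _ _ _ _ t') // ?Hd ?Hd' //; try lra.
  by move=> z Hz; split; apply: H; lra.
pose p := psub (e x) (f y).
have p0 : 0 < dot p p by apply: (@shift_neq0 e (f y) x); apply: H.
(* Each of the two projections on [p] moves by less than half of [dot p p], so their difference
   stays positive. *)
have [|d1 d10 Hd1] := @dot_near e p x (dot p p / 2); first lra.
have [|d2 d20 Hd2] := @dot_near f p y (dot p p / 2); first lra.
exists d2 => // t t' ? ? ? ? ?; exists d1 => // u v ? ? ? ? ?.
apply: (@wind_local _ _ _ _ _ _ p); try lra.
move=> s z Hs Hz.
have /Hd1 /Rabs_def2 : Rabs (s - x) < d1 by apply: Rabs_def1; lra.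
have /Hd2 /Rabs_def2 : Rabs (z - y) < d2 by apply: Rabs_def1; lra.
have dotB q r : dot p (psub q r) = dot p q - dot p r by rewrite /dot /psub /=; ring.
have : dot p p = dot p (e x) - dot p (f y) by rewrite -dotB.
rewrite dotB; lra.
Qed.

(** * First-order analysis at a transversal crossing *)

Lemma derive_near (f : R -> R) x l eps : is_derive f x l -> 0 < eps ->
  exists2 d, 0 < d &
    forall h, Rabs h < d -> Rabs (f (x + h) - f x - l * h) <= eps * Rabs h.
Proof.
move=> /is_derive_Reals Hf He; have [d Hd] := Hf eps He.
exists d; first exact: cond_pos.
move=> h Hh; have [->|h0] := Req_dec h 0.
  by rewrite Rplus_0_r !Rminus_diag Rmult_0_r Rminus_diag Rabs_R0; lra.
have := Hd h h0 Hh.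
have -> : f (x + h) - f x - l * h = ((f (x + h) - f x) / h - l) * h by field.
rewrite Rabs_mult; have := Rabs_pos h; nra.
Qed.

(** The coordinate of absolute value at least [m] contributes at least [(3 m / 4)^2]. The other
    product is at least minus the square of half the difference of its errors, hence at least
    [- (m / 4)^2]. *)
Lemma dot_perturb (x y a b c d m : R) : 0 < m -> (m <= Rabs x \/ m <= Rabs y) ->
  Rabs a <= m / 4 -> Rabs b <= m / 4 -> Rabs c <= m / 4 -> Rabs d <= m / 4 ->
  0 < (x + a) * (x + b) + (y + c) * (y + d).
Proof.
move=> m0 H /Rabs_le_between Ha /Rabs_le_between Hb /Rabs_le_between Hc /Rabs_le_between Hd.
have low z p q : - (m / 4) <= p <= m / 4 -> - (m / 4) <= q <= m / 4 ->
    - (m * m / 16) <= (z + p) * (z + q).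
  move=> Hp Hq; have : (p - q) * (p - q) <= m * m / 4 by nra.
  by have := Rle_0_sqr (z + (p + q) / 2); rewrite /Rsqr; nra.
have big z p q : m <= Rabs z -> - (m / 4) <= p <= m / 4 -> - (m / 4) <= q <= m / 4 ->
    m * m * (9 / 16) <= (z + p) * (z + q).
  rewrite /Rabs; case: Rcase_abs => ? ? ? ?; last nra.
  have -> : (z + p) * (z + q) = (- z - p) * (- z - q) by ring.
  nra.
case: H => /big H.
  by have := H a b Ha Hb; have := low y c d Hc Hd; nra.
by have := H c d Hc Hd; have := low x a b Ha Hb; nra.
Qed.

(** Negating a vector does not affect the angle it sweeps, while reversing time changes its sign. *)
Lemma ang_reflect (g : curve) p s d : 0 <= d ->
  (forall t, s - d <= t <= s + d -> g t <> p) ->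
  ang (affine (-1) (-1) (2 * s) p g) (s - d) (s + d) = - ang (shift g p) (s - d) (s + d).
Proof.
move=> d0 H; rewrite /ang.
rewrite (RInt_ext _ (fun y => scal (-1) (dangle (shift g p) (-1 * y + 2 * s)))); last first.
  move=> x _; rewrite /scal /= /mult /= /dangle /vel /pos /cross /dot /= /Rdiv.
  rewrite !(Rmult_comm (-1) (_ - _)) /=.
  set u := cx g _ - _; set v := cy g _ - _.
  have -> : u * -1 * (u * -1) + v * -1 * (v * -1) = u * u + v * v by ring.
  ring.
rewrite RInt_comp_lin.
  have -> : -1 * (s - d) + 2 * s = s + d by ring.
  have -> : -1 * (s + d) + 2 * s = s - d by ring.
  by rewrite -(opp_RInt_swap (dangle (shift g p)) (s + d)) ?Ropp_involutive //;
    apply/ex_RInt_swap/ex_RInt_dangle => [|t Ht]; [lra|apply/shift_neq0/H].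
have -> : -1 * (s - d) + 2 * s = s + d by ring.
have -> : -1 * (s + d) + 2 * s = s - d by ring.
by apply/ex_RInt_swap/ex_RInt_dangle => [|t Ht]; [lra|apply/shift_neq0/H].
Qed.


(** Both vectors in the dot product agree, up to a first-order remainder, with the linear part
    [(L1, L2)] of [e - f] at [(x, y)]. Transversality makes this linear map invertible, so it
    dominates the remainders. *)
Lemma transversal_near (e f : curve) s t : e s = f t -> cross (vel e s) (vel f t) <> 0 ->
  exists2 d, 0 < d & forall x y, Rabs x < d -> Rabs y < d -> x <> 0 \/ y <> 0 ->
    0 < dot (psub (e (s + x)) (f (t + y))) (popp (psub (e (s - x)) (f (t - y)))).
Proof.
move=> Eq; rewrite /cross /=.
set a1 := dcx e s; set a2 := dcy e s; set b1 := dcx f t; set b2 := dcy f t => D0.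
pose D := a1 * b2 - a2 * b1.
have D1 : 0 < Rabs D by apply: Rabs_pos_lt.
pose K := Rabs a1 + Rabs a2 + Rabs b1 + Rabs b2.
have K0 : 0 < K.
  apply: Rnot_le_lt => HK; apply: D0.
  move: (Rabs_pos a1) (Rabs_pos a2) (Rabs_pos b1) (Rabs_pos b2) => ? ? ? ?.
  have -> : a1 = 0 by apply: Rabs_eq_0; rewrite /K in HK; lra.
  have -> : a2 = 0 by apply: Rabs_eq_0; rewrite /K in HK; lra.
  ring.
(* Chosen so that the bound [mK] below yields [eps * r <= m / 4], the tolerance of [dot_perturb]. *)
pose eps := Rabs D / (4 * K).
have eps0 : 0 < eps by apply: Rdiv_lt_0_compat; lra.
have [d1 d10 H1] := derive_near (@derx e s) eps0.
have [d2 d20 H2] := derive_near (@dery e s) eps0.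
have [d3 d30 H3] := derive_near (@derx f t) eps0.
have [d4 d40 H4] := derive_near (@dery f t) eps0.
exists (Rmin (Rmin d1 d2) (Rmin d3 d4)); first by do !apply: Rmin_pos.
move=> x y Hx Hy xy0.
have [m1 m2] := (Rmin_l (Rmin d1 d2) (Rmin d3 d4), Rmin_r (Rmin d1 d2) (Rmin d3 d4)).
have [m3 m4] := (Rmin_l d1 d2, Rmin_r d1 d2).
have [m5 m6] := (Rmin_l d3 d4, Rmin_r d3 d4).
pose r := Rabs x + Rabs y.
have r0 : 0 < r.
  by case: xy0 => /Rabs_pos_lt; rewrite /r; have := Rabs_pos x; have := Rabs_pos y; lra.
pose L1 := a1 * x - b1 * y; pose L2 := a2 * x - b2 * y.
pose m := Rmax (Rabs L1) (Rabs L2).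
have [ML1 ML2] := (Rmax_l (Rabs L1) (Rabs L2), Rmax_r (Rabs L1) (Rabs L2)); rewrite -/m in ML1 ML2.
(* Cramer's rule recovers [x] and [y] from [L1] and [L2], with determinant [D] up to sign. *)
have mK : Rabs D * r <= K * m.
  have E1 : Rabs D * Rabs y <= (Rabs a1 + Rabs a2) * m.
    rewrite -Rabs_mult (_ : D * y = a2 * L1 - a1 * L2); last by rewrite /D /L1 /L2; ring.
    apply: Rle_trans (Rabs_triang _ _) _; rewrite Rabs_Ropp !Rabs_mult.
    by have := Rabs_pos a1; have := Rabs_pos a2; nra.
  have E2 : Rabs D * Rabs x <= (Rabs b1 + Rabs b2) * m.
    rewrite -Rabs_mult (_ : D * x = b2 * L1 - b1 * L2); last by rewrite /D /L1 /L2; ring.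
    apply: Rle_trans (Rabs_triang _ _) _; rewrite Rabs_Ropp !Rabs_mult.
    by have := Rabs_pos b1; have := Rabs_pos b2; nra.
  by rewrite /r /K; nra.
have epsr : eps * r <= m / 4.
  have -> : eps * r = (Rabs D * r) / K / 4 by rewrite /eps; field; lra.
  apply: Rmult_le_compat_r; first lra.
  by apply/Rle_div_l => //; lra.
have Dr0 : 0 < Rabs D * r by apply: Rmult_lt_0_compat.
have m0 : 0 < m by nra.
have [Eq1 Eq2] : cx e s = cx f t /\ cy e s = cy f t by case: Eq.
have x' : Rabs (- x) = Rabs x := Rabs_Ropp x.
have y' : Rabs (- y) = Rabs y := Rabs_Ropp y.
have mH : m <= Rabs L1 \/ m <= Rabs L2.
  by rewrite /m /Rmax; case: Rle_dec => _; [right | left]; apply: Rle_refl.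
pose er (g : R -> R) z l h := g (z + h) - g z - l * h.
have tri p q : Rabs p <= eps * Rabs x -> Rabs q <= eps * Rabs y ->
    Rabs (p - q) <= m / 4 /\ Rabs (q - p) <= m / 4.
  move=> Hp Hq; rewrite (Rabs_minus_sym q p).
  have := Rabs_triang p (- q); rewrite Rabs_Ropp -/(p - q).
  by rewrite /r in epsr; lra.
have := @dot_perturb L1 L2
  (er (cx e) s a1 x - er (cx f) t b1 y) (er (cx f) t b1 (- y) - er (cx e) s a1 (- x))
  (er (cy e) s a2 x - er (cy f) t b2 y) (er (cy f) t b2 (- y) - er (cy e) s a2 (- x)) m m0 mH.
have -> : dot (psub (e (s + x)) (f (t + y))) (popp (psub (e (s - x)) (f (t - y)))) =
   (L1 + (er (cx e) s a1 x - er (cx f) t b1 y)) * (L1 + (er (cx f) t b1 (- y) - er (cx e) s a1 (- x))) +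
   (L2 + (er (cy e) s a2 x - er (cy f) t b2 y)) * (L2 + (er (cy f) t b2 (- y) - er (cy e) s a2 (- x))).
  rewrite /dot /pos /= /er /L1 /L2 Eq1 Eq2.
  rewrite -!/(Rminus _ _).
  congr (_ * _ + _ * _); ring.
have [||G1 _] := tri (er (cx e) s a1 x) (er (cx f) t b1 y); [by apply: H1; lra | by apply: H3; lra |].
have [||G2 _] := tri (er (cy e) s a2 x) (er (cy f) t b2 y); [by apply: H2; lra | by apply: H4; lra |].
rewrite -x' -y' in tri.
have [||_ G3] := tri (er (cx e) s a1 (- x)) (er (cx f) t b1 (- y)); [by apply: H1; lra | by apply: H3; lra |].
have [||_ G4] := tri (er (cy e) s a2 (- x)) (er (cy f) t b2 (- y)); [by apply: H2; lra | by apply: H4; lra |].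
exact.
Qed.

Lemma affine_reflect (g : curve) p s t :
  affine (-1) (-1) (2 * s) p g t = popp (psub (g (2 * s - t)) p).
Proof.
rewrite /pos /popp /=; have -> : -1 * t + 2 * s = 2 * s - t by ring.
by congr pair; ring.
Qed.

(* Near a transversal zero [F (s, t) = e s - f t] is almost odd, so that opposite
   sides of the square contribute almost equally; the error is twice the angle
   from [F] at a corner to [- F] at the opposite corner. *)
Lemma wind_odd (e f : curve) s t : e s = f t -> cross (vel e s) (vel f t) <> 0 ->
  exists2 d, 0 < d & forall h, 0 < h -> h < d ->
    (forall s' t', s - h <= s' <= s + h -> t - h <= t' <= t + h ->
       e s' = f t' -> s' = s /\ t' = t) /\
    exists k : Z, wind e f (s - h) (s + h) (t - h) (t + h) = 2 * PI * (1 + 2 * IZR k).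
Proof.
move=> Eq D0; have [d d0 Hd] := transversal_near Eq D0.
exists d => // h h0 hd.
have pos2 s' t' : s - h <= s' <= s + h -> t - h <= t' <= t + h -> s' <> s \/ t' <> t ->
    0 < dot (psub (e s') (f t')) (popp (psub (e (2 * s - s')) (f (2 * t - t')))).
  move=> Hs Ht H; have := Hd (s' - s) (t' - t).
  have -> : s + (s' - s) = s' by ring.
  have -> : t + (t' - t) = t' by ring.
  have -> : s - (s' - s) = 2 * s - s' by ring.
  have -> : t - (t' - t) = 2 * t - t' by ring.
  by apply; [apply: Rabs_def1; lra | apply: Rabs_def1; lra | lra].
have uniq s' t' : s - h <= s' <= s + h -> t - h <= t' <= t + h ->
    e s' = f t' -> s' = s /\ t' = t.
  move=> Hs Ht E; apply: Classical_Prop.NNPP => H.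
  have /dot_pos_l : 0 < dot (psub (e s') (f t')) (popp (psub (e (2 * s - s')) (f (2 * t - t')))).
    apply: pos2 => //; have [?|?] := Req_dec s' s; last by left.
    by right => ?; apply: H.
  by rewrite E /dot /= !Rminus_diag; lra.
split => //.
have ne s' t' : s - h <= s' <= s + h -> t - h <= t' <= t + h -> s' <> s \/ t' <> t ->
    e s' <> f t' by move=> Hs Ht H /(uniq _ _ Hs Ht); tauto.
pose F s t := psub (e s) (f t).
have R1 : 2 * s - (s + h) = s - h by ring.
have R2 : 2 * s - (s - h) = s + h by ring.
have R3 : 2 * t - (t + h) = t - h by ring.
have R4 : 2 * t - (t - h) = t + h by ring.
have popp2 q : popp (popp q) = q by case: q => x y; rewrite /popp /= !Ropp_involutive.
have dot_opp p q : dot (popp p) q = dot p (popp q) by rewrite /dot /=; ring.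
have top : - ang (shift e (f (t + h))) (s - h) (s + h) =
    ang (shift e (f (t - h))) (s - h) (s + h)
    + (rang (F (s + h) (t - h)) (popp (F (s - h) (t + h)))
       - rang (F (s - h) (t - h)) (popp (F (s + h) (t + h)))).
  rewrite -ang_reflect; [|lra|by move=> z Hz; apply: ne; lra].
  have := @ang_compare (shift e (f (t - h))) (affine (-1) (-1) (2 * s) (f (t + h)) e) (s - h) (s + h).
  rewrite !affine_reflect !shiftE R1 R2 -!/(F _ _) => <-; first ring; first lra.
  move=> z Hz; rewrite affine_reflect shiftE -R4; apply: pos2; lra.
have left : - ang (shift f (e (s - h))) (t - h) (t + h) =
    ang (shift f (e (s + h))) (t - h) (t + h)
    + (- rang (F (s - h) (t - h)) (popp (F (s + h) (t + h)))
       - rang (F (s + h) (t - h)) (popp (F (s - h) (t + h)))).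
  rewrite -ang_reflect; [|lra|by move=> z Hz; apply/not_eq_sym/ne; lra].
  have := @ang_compare (shift f (e (s + h))) (affine (-1) (-1) (2 * t) (e (s - h)) f) (t - h) (t + h).
  rewrite !affine_reflect !shiftE R3 R4 !(psub_opp (f _)) !popp2 -!/(F _ _).
  rewrite (rang_oppl (F (s + h) (t - h))) (rang_swap (F (s - h) (t - h))) => <-; first ring; first lra.
  move=> z Hz; rewrite affine_reflect !shiftE !(psub_opp (f _)) popp2 dot_opp.
  by rewrite -R1; apply: pos2; lra.
have A1 : rotp (ang (shift e (f (t - h))) (s - h) (s + h)) (F (s - h) (t - h)) (F (s + h) (t - h)).
  by apply: ang_rotp; [lra | move=> z Hz; apply/shift_neq0/ne; lra].
have A2 : rotp (ang (shift f (e (s + h))) (t - h) (t + h)) (F (s + h) (t - h)) (F (s + h) (t + h)).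
  have /rotp_opp : rotp (ang (shift f (e (s + h))) (t - h) (t + h))
      (popp (F (s + h) (t - h))) (popp (F (s + h) (t + h))); last by rewrite !popp2.
  rewrite -!psub_opp.
  by apply: ang_rotp; [lra | move=> z Hz; apply/shift_neq0/not_eq_sym/ne; lra].
have H0 : 0 < dot (F (s - h) (t - h)) (popp (F (s + h) (t + h))).
  by rewrite -R2 -R4; apply: pos2; lra.
have /rotp_pi := rotp_rang H0; rewrite popp2 => A3.
(* Two consecutive sides lead from one corner to the opposite one, which fixes [a1 + a2] modulo 2
   pi. The whole boundary sweeps twice that amount up to the correction, so it is known modulo 4 pi,
   and this is what gives a parity. *)
have [k Hk] := rotp_unique (dot_pos_l H0) (rotp_trans A1 A2) A3.
exists k; rewrite /wind.
set a1 := ang (shift e (f (t - h))) _ _ in top Hk *.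
set a2 := ang (shift f (e (s + h))) _ _ in left Hk *.
transitivity (2 * (a1 + a2) - 2 * rang (F (s - h) (t - h)) (popp (F (s + h) (t + h)))).
  by lra.
rewrite Hk; ring.
Qed.


(** * Counting crossings modulo 2 by the winding number *)

Lemma list_gap (l : list R) x : ~ List.In x l ->
  exists2 d, 0 < d & forall y, List.In y l -> d <= Rabs (y - x).
Proof.
elim: l => [|y l IH] Hx; first by exists 1 => //; lra.
have [|d d0 Hd] := IH; first by move=> H; apply: Hx; right.
have yx : 0 < Rabs (y - x) by apply: Rabs_pos_lt => H; apply: Hx; left; lra.
exists (Rmin d (Rabs (y - x))); first exact: Rmin_pos.
move=> z [<-|/Hd Hz]; first exact: Rmin_r.
exact: Rle_trans (Rmin_l _ _) Hz.
Qed.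

(** Induction on the number of crossing parameters of [f]: a thin strip around one of them, [t],
    splits off, and the others are divided between the two remaining rectangles. Injectivity of [e]
    ensures that the strip contains a single zero. *)
Lemma wind_count (e f : curve) (l : list R) u v : 0 <= u -> u <= v -> v <= 1 ->
  (forall s s', 0 <= s <= 1 -> 0 <= s' <= 1 -> e s = e s' -> s = s') ->
  (forall s t, 0 <= s <= 1 -> 0 <= t <= 1 -> e s = f t ->
     0 < s < 1 /\ cross (vel e s) (vel f t) <> 0) ->
  List.NoDup l ->
  (forall t, List.In t l <-> u <= t <= v /\ exists2 s, 0 <= s <= 1 & e s = f t) ->
  ~ List.In u l -> ~ List.In v l ->
  exists k : Z, wind e f 0 1 u v = 2 * PI * (INR (length l) + 2 * IZR k).
Proof.
move=> u0 uv v1 einj zero.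
have [n] := ubnP (length l); elim: n l u v u0 uv v1 => // n IH [|t l] u v u0 uv v1 Hn ndl Hl ul vl.
  exists Z0; rewrite wind_free //=; [ring | lra | ].
  by move=> s t Hs Ht E; have [_ H] := Hl t; apply: H; split => //; exists s.
have [ndt nd] : ~ List.In t l /\ List.NoDup l by inversion ndl.
have [Ht [s Hs Est]] : u <= t <= v /\ exists2 s, 0 <= s <= 1 & e s = f t.
  by apply/Hl; left.
have [|Hs' tr] := zero s t Hs _ Est; first lra.
have [d1 d10 Hd1] := wind_odd Est tr.
have [d2 d20 Hd2] := list_gap ndt.
have Htu : u < t by have [//|E] := Rle_lt_or_eq_dec u t ltac:(lra); case: ul; left.
have Htv : t < v by have [//|E] := Rle_lt_or_eq_dec t v ltac:(lra); case: vl; left.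
(* Small enough for [wind_odd], for separating [t] from the other parameters in [l], and for keeping
   the square inside the rectangle; halving makes all these bounds strict. *)
pose h := Rmin (Rmin d1 d2) (Rmin (Rmin s (1 - s)) (Rmin (t - u) (v - t))) / 2.
have [h0 [hd1 [hd2 [hs [hs1 [hu hv]]]]]] :
    0 < h /\ h < d1 /\ h < d2 /\ h < s /\ h < 1 - s /\ h < t - u /\ h < v - t.
  rewrite /h; set m := Rmin _ (Rmin _ (Rmin _ _)).
  have m0 : 0 < m by do ?apply: Rmin_pos; lra.
  have := Rmin_l (Rmin d1 d2) (Rmin (Rmin s (1 - s)) (Rmin (t - u) (v - t))).
  have := Rmin_r (Rmin d1 d2) (Rmin (Rmin s (1 - s)) (Rmin (t - u) (v - t))).
  have := Rmin_l (Rmin s (1 - s)) (Rmin (t - u) (v - t)).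
  have := Rmin_r (Rmin s (1 - s)) (Rmin (t - u) (v - t)).
  have := Rmin_l d1 d2; have := Rmin_r d1 d2.
  have := Rmin_l s (1 - s); have := Rmin_r s (1 - s).
  have := Rmin_l (t - u) (v - t); have := Rmin_r (t - u) (v - t).
  rewrite -/m; lra.
have [_ [k Hk]] := Hd1 h h0 hd1.
have only s' t' : 0 <= s' <= 1 -> t - h <= t' <= t + h -> e s' = f t' -> s' = s /\ t' = t.
  move=> Hs1 Ht1 E.
  have /Hl [Et|/Hd2] : u <= t' <= v /\ exists2 s, 0 <= s <= 1 & e s = f t'.
  - by split; [lra | exists s'].
  - by split => //; apply: einj => //; rewrite E Est Et.
  - have : Rabs (t' - t) <= h by apply: Rabs_le; lra.
    lra.
(* The strip is cut into the square around [(s, t)] and two rectangles free of zeros. *)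
have midE : wind e f 0 1 (t - h) (t + h) = 2 * PI * (1 + 2 * IZR k).
  rewrite (@wind_split_s e f 0 (s - h) 1); [|lra|lra|]; last first.
    by move=> s' Hs1; split => E; have := only _ _ Hs1 _ E; lra.
  rewrite (@wind_split_s e f (s - h) (s + h) 1); [|lra|lra|]; last first.
    by move=> s' Hs1; split => E; have := only s' _ _ _ E; lra.
  rewrite Hk !(@wind_free e f); try lra.
    by move=> s' t' Hs1 Ht1 E; have := only s' _ _ Ht1 E; lra.
  by move=> s' t' Hs1 Ht1 E; have := only s' _ _ Ht1 E; lra.
have side t' : 0 <= t' <= 1 -> e 0 <> f t' /\ e 1 <> f t'.
  by move=> Ht1; split => E; [have := zero 0 t' _ Ht1 E | have := zero 1 t' _ Ht1 E]; lra.
rewrite (@wind_split_t e f 0 1 u (t - h) v); [|lra|lra|]; last first.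
  by move=> t' ?; apply: side; lra.
rewrite (@wind_split_t e f 0 1 (t - h) (t + h) v); [|lra|lra|]; last first.
  by move=> t' ?; apply: side; lra.
pose low t' := if Rlt_dec t' t then true else false.
have lowP t' : low t' = true <-> t' < t by rewrite /low; case: Rlt_dec.
have highP t' : negb (low t') = true <-> t <= t' by rewrite /low; case: Rlt_dec => /= ?; split => //; lra.
have lenE := List.filter_length low l.
have lt_len p : (length (List.filter p l) < n)%N.
  by apply: (@leq_ltn_trans (length l)) => //; apply/leP/List.filter_length_le.
have nol t' : List.In t' l -> u <= t' <= v /\ t' <> t.
  move=> Hin; split; last by move=> E; apply: ndt; rewrite -E.
  by have [H _] := Hl t'; case: H => //; right.
have [kl Hkl] : exists kl : Z, wind e f 0 1 u (t - h) =
    2 * PI * (INR (length (List.filter low l)) + 2 * IZR kl).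
  apply: IH => //; try lra.
  - exact: List.NoDup_filter.
  - move=> t'; rewrite List.filter_In lowP; split.
      move=> [Hin Htt]; have [H _] := Hl t'; case: H => [|Hb Hz]; first by right.
      split => //; have := Hd2 _ Hin; rewrite Rabs_left; lra.
    move=> [Hb Hz]; split; last lra.
    by have [_ []] := Hl t'; [split => //; lra | lra |].
  - by rewrite List.filter_In => -[H _]; apply: ul; right.
  - rewrite List.filter_In => -[/Hd2 H _].
    by move: H; rewrite Rabs_left; lra.
have [kr Hkr] : exists kr : Z, wind e f 0 1 (t + h) v =
    2 * PI * (INR (length (List.filter (fun x => negb (low x)) l)) + 2 * IZR kr).
  apply: IH => //; try lra.
  - exact: List.NoDup_filter.
  - move=> t'; rewrite List.filter_In highP; split.
      move=> [Hin Htt]; have [H _] := Hl t'; case: H => [|Hb Hz]; first by right.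
      split => //; have [_ ?] := nol _ Hin.
      by have := Hd2 _ Hin; rewrite Rabs_right; lra.
    move=> [Hb Hz]; split; last lra.
    by have [_ []] := Hl t'; [split => //; lra | lra |].
  - rewrite List.filter_In => -[/Hd2 H _].
    by move: H; rewrite Rabs_right; lra.
  - by rewrite List.filter_In => -[H _]; apply: vl; right.
exists (Z.add kl (Z.add k kr)); rewrite midE Hkl Hkr.
have -> : length (t :: l) = S (length l) by [].
rewrite -lenE S_INR plus_INR !plus_IZR; ring.
Qed.


(** * Parity of the crossings of two disjoint edges of an embedding *)

Lemma smooth_curve (g : nat -> R -> point) : smooth_tower g ->
  exists c : curve, (forall t, c t = g 0%N t) /\ (forall t, vel c t = g 1%N t).
Proof.
move=> Hg.
have der1 n t : is_derive (fun t => fst (g n t)) t (fst (g n.+1 t)).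
  by apply/is_derive_Reals; case: (Hg n t).
have der2 n t : is_derive (fun t => snd (g n t)) t (snd (g n.+1 t)).
  by apply/is_derive_Reals; case: (Hg n t).
have cont1 t : continuous (fun t => fst (g 1%N t)) t.
  by apply: ex_derive_continuous; eexists; apply: der1.
have cont2 t : continuous (fun t => snd (g 1%N t)) t.
  by apply: ex_derive_continuous; eexists; apply: der2.
exists (Curve (der1 0%N) (der2 0%N) cont1 cont2).
by split=> t; rewrite [RHS]surjective_pairing.
Qed.

Lemma list_preimage (S T : Type) (g : S -> T) (Q : S -> Prop) (l : list T) :
  (forall p, List.In p l -> exists2 t, Q t & g t = p) ->
  exists2 l', List.map g l' = l & forall t, List.In t l' -> Q t.
Proof.
elim: l => [|p l IH] H; first by exists nil.
have [|l' E Hl'] := IH; first by move=> q Hq; apply: H; right.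
have [|t Qt Et] := H p; first by left.
exists (t :: l'); first by rewrite /= Et E.
by move=> t' [<-|/Hl'].
Qed.

Lemma list_of_finite (T : Type) (P : T -> Prop) (L : list T) :
  (forall p, P p -> List.In p L) ->
  exists l, List.NoDup l /\ forall p, List.In p l <-> P p.
Proof.
elim: L P => [|q L IH] P HP.
  by exists nil; split => [|p]; [constructor | split => // /HP].
have [|l [nd Hl]] := IH (fun p => P p /\ p <> q).
  by move=> p [/HP [->|] //].
have [Pq|nPq] := classic (P q).
  exists (q :: l); split.
    by constructor => // /Hl [].
  move=> p; split; first by move=> [<-|/Hl []].
  by move=> Pp; have [->|ne] := classic (p = q); [left | right; apply/Hl].
exists l; split => // p; split; first by case/Hl.
by move=> Pp; apply/Hl; split => // E; apply: nPq; rewrite -E.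
Qed.

(** An arbitrary choice of polar angle for each vector. No continuity is required, because it only
    enters modulo 2 pi. *)
Definition arg (p : point) : R := epsilon (inhabits 0) (fun a => rotp a (1, 0) p).

Lemma argP (p : point) : p <> (0, 0) -> rotp (arg p) (1, 0) p.
Proof. by move=> /dot_gt0 /arg_exists; apply: epsilon_spec. Qed.

Lemma e1_gt0 : 0 < dot (1, 0) (1, 0).
Proof. by rewrite /dot /=; lra. Qed.

Lemma psub_neq0 (p q : point) : p <> q -> psub p q <> (0, 0).
Proof.
move: p q => [x y] [x' y'] H [/= H1 H2]; apply: H; congr pair; lra.
Qed.

Lemma arg_opp (p q : point) : p <> q ->
  exists m : Z, arg (psub q p) = arg (psub p q) + PI + 2 * PI * IZR m.
Proof.
move=> pq; have H1 := argP (psub_neq0 pq).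
have H2 := argP (psub_neq0 (not_eq_sym pq)).
apply: rotp_unique e1_gt0 H2 _; rewrite (psub_opp q); exact: rotp_pi.
Qed.

(** Both the swept angle and the difference of arguments rotate [c 0 - p] to [c 1 - p], up to
    scaling. *)
Lemma ang_arg (c : curve) p : (forall t, 0 <= t <= 1 -> c t <> p) ->
  exists k : Z, ang (shift c p) 0 1 =
    arg (psub (c 1) p) - arg (psub (c 0) p) + 2 * PI * IZR k.
Proof.
move=> H.
have A : rotp (ang (shift c p) 0 1) (psub (c 0) p) (psub (c 1) p).
  by apply: ang_rotp; [lra | move=> t Ht; apply/shift_neq0/H].
have [||k Hk] := rotp_unique e1_gt0
  (rotp_trans (argP (psub_neq0 _)) A) (argP (psub_neq0 _)).
- by apply: H; lra.
- by apply: H; lra.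
- by exists k; lra.
Qed.

(** The choice made by [epsilon] in [ncross] is meaningful once the common points form a finite set.
    Properness bounds only those that are not vertex-points, hence the last hypothesis. *)
Lemma ncrossE (V : finType) (adj : rel V) (eta : embedding V) (e1 e2 : {set V}) :
  proper_embedding adj eta -> is_edge adj e1 -> is_edge adj e2 -> e1 != e2 ->
  (forall p, img eta e1 p -> img eta e2 p -> ~ is_vertex_point eta p) ->
  exists l : list point, [/\ List.NoDup l, length l = ncross eta e1 e2 &
    forall p, List.In p l <-> (img eta e1 p /\ img eta e2 p)].
Proof.
move=> [_ [_ [L HL]]] E1 E2 ne Hv.
have [|l [nd Hl]] := @list_of_finite _ (fun p => img eta e1 p /\ img eta e2 p) L.
  move=> p [H1 H2]; apply: HL; last exact: Hv.
  by exists e1, e2; split => //; split => //; split.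
have : exists n l, List.NoDup l /\ List.length l = n /\
  forall p, List.In p l <-> (img eta e1 p /\ img eta e2 p).
  by exists (length l), l.
by move/(epsilon_spec (inhabits 0%N)) => [l' [? [? ?]]]; exists l'.
Qed.


Lemma edge_ends (V : finType) (adj : rel V) (eta : embedding V) e :
  irreflexive adj -> is_embedding adj eta -> is_edge adj e ->
  exists u v, [/\ u != v, e = [set u; v], ecurve eta e 0 = vpos eta u
    & ecurve eta e 1 = vpos eta v].
Proof.
move=> irr [_ emb] Ee; have [_ [[u [v [Euv [E0 E1]]]] _]] := emb e Ee.
exists u, v; split => //; apply/eqP => uv.
move/existsP: Ee => [u' /existsP[v' /andP[a' /eqP E']]].
have : #|e| = #|[set u'; v']| by rewrite -E'.
rewrite Euv uv !cards2 eqxx; case: eqP => // u'v'.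
by move: a'; rewrite u'v' irr.
Qed.

(** A vertex-point lying on an edge-curve belongs to an end of that edge, and disjoint edges share
    no end. *)
Lemma crossing_not_vertex (V : finType) (adj : rel V) (eta : embedding V) e1 e2 :
  is_embedding adj eta -> is_edge adj e1 -> is_edge adj e2 -> [disjoint e1 & e2] ->
  forall p, img eta e1 p -> img eta e2 p -> ~ is_vertex_point eta p.
Proof.
move=> [_ emb] E1 E2 dis p [s [Hs Es]] [t [Ht Et]] [w Ew].
have [_ [_ [_ H1]]] := emb e1 E1; have [_ [_ [_ H2]]] := emb e2 E2.
have [w1|w1] := boolP (w \in e1); last by apply: (H1 w s) => //; rewrite Es.
have [w2|w2] := boolP (w \in e2); last by apply: (H2 w t) => //; rewrite Et.
by move: (disjointFr dis w1); rewrite w2.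
Qed.

Lemma crossing_wind (V : finType) (adj : rel V) (eta : embedding V) e1 e2 (c1 c2 : curve) :
  irreflexive adj -> proper_embedding adj eta ->
  is_edge adj e1 -> is_edge adj e2 -> [disjoint e1 & e2] ->
  (forall t, c1 t = ecurve eta e1 t) -> (forall t, vel c1 t = tower eta e1 1 t) ->
  (forall t, c2 t = ecurve eta e2 t) -> (forall t, vel c2 t = tower eta e2 1 t) ->
  exists k : Z, wind c1 c2 0 1 0 1 = 2 * PI * (INR (ncross eta e1 e2) + 2 * IZR k).
Proof.
move=> irr prop E1 E2 dis P1 V1 P2 V2.
have emb : is_embedding adj eta by case: prop.
have nv := crossing_not_vertex emb E1 E2 dis.
have [u [v [uv e1E c10 c11]]] := edge_ends irr emb E1.
have [u' [v' [uv' e2E c20 c21]]] := edge_ends irr emb E2.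
have ne : e1 != e2.
  apply/eqP => E; have : u \in e1 by rewrite e1E !inE eqxx.
  by move=> ue; move: (disjointFr dis ue); rewrite -E ue.
have [l [nd ln Hl]] := ncrossE prop E1 E2 ne nv.
(* The crossing points are pulled back to parameters of [c2], as [wind_count] counts parameters.
   Injectivity of the second edge-curve makes this a bijection. *)
have [|T ET HT] := @list_preimage R point c2 in01 l.
  by move=> p /Hl [_ [t [Ht Et]]]; exists t => //; rewrite P2.
have inj1 : forall s t, in01 s -> in01 t -> ecurve eta e1 s = ecurve eta e1 t -> s = t.
  by case: emb => _ /(_ _ E1) [_ [_ []]].
have inj2 : forall s t, in01 s -> in01 t -> ecurve eta e2 s = ecurve eta e2 t -> s = t.
  by case: emb => _ /(_ _ E2) [_ [_ []]].
have TP t : List.In t T <-> 0 <= t <= 1 /\ exists2 s, 0 <= s <= 1 & c1 s = c2 t.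
  split=> [Hin|[Ht [s Hs Est]]].
    split; first exact: HT.
    have /Hl [[s [Hs Es]] _] : List.In (c2 t) l by rewrite -ET; apply: List.in_map.
    by exists s => //; rewrite P1.
  have : List.In (c2 t) l.
    by apply/Hl; split; [exists s; rewrite -P1 | exists t; rewrite -P2].
  rewrite -ET => /List.in_map_iff [t' [Et' Hin]].
  rewrite (_ : t = t') //; apply: inj2 => //; first exact: HT.
  by rewrite -!P2.
have nv2 s t : in01 s -> in01 t -> c1 s = c2 t -> ~ is_vertex_point eta (c1 s).
  by move=> Hs Ht E; apply: nv; [exists s | exists t; rewrite -P2].
have i0 : in01 0 by rewrite /in01; lra.
have i1 : in01 1 by rewrite /in01; lra.
rewrite -ln -ET List.length_map.
apply: wind_count => //; try lra.
- by move=> s s' Hs Hs' E; apply: inj1 => //; rewrite -!P1.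
- move=> s t Hs Ht Est; have nvs := nv2 s t Hs Ht Est; split.
    have [s0|s0] := Req_dec s 0; first by case: nvs; exists u; rewrite s0 P1.
    have [s1|s1] := Req_dec s 1; first by case: nvs; exists v; rewrite s1 P1.
    lra.
  rewrite /cross V1 V2; case: prop => _ [tr _].
  by apply: (tr e1 e2 s t) => //; rewrite -?P1 -?P2.
- by apply: (List.NoDup_map_inv c2); rewrite ET.
- move=> /TP [_ [s Hs Es]]; apply: (nv2 s 0) => //.
  by exists u'; rewrite Es P2.
- move=> /TP [_ [s Hs Es]]; apply: (nv2 s 1) => //.
  by exists v'; rewrite Es P2.
Qed.

(** Writing the four angles of the winding number through [arg] leaves the integers [k], and for
    each pair of ends [x], [y] a difference of [arg (y - x)] and [arg (x - y)], which contributes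
    the integer [m x y]. The four half turns cancel, and parities are taken. *)
Lemma crossing_parity (V : finType) (adj : rel V) (eta : embedding V) :
  irreflexive adj -> proper_embedding adj eta ->
  exists (k : {set V} -> V -> bool) (b : V -> V -> bool),
    (forall x y, x != y -> b y x = ~~ b x y) /\
    (forall e f, is_edge adj e -> is_edge adj f -> [disjoint e & f] ->
      odd (ncross eta e f) =
        \big[addb/false]_(y in f) k e y (+) \big[addb/false]_(x in e) k f x
        (+) \big[addb/false]_(x in e) \big[addb/false]_(y in f) b x y).
Proof.
move=> irr prop; have emb : is_embedding adj eta by case: prop.
pose P e (c : curve) := (forall t, c t = ecurve eta e t) /\ (forall t, vel c t = tower eta e 1 t).
pose c e := epsilon (inhabits (cst (0, 0))) (P e).
have Pc e : is_edge adj e -> P e (c e).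
  move=> Ee; apply: epsilon_spec; apply: smooth_curve.
  by case: emb => _ /(_ e Ee) [].
pose Q e y k := ang (shift (c e) (vpos eta y)) 0 1 =
    arg (psub (c e 1) (vpos eta y)) - arg (psub (c e 0) (vpos eta y)) + 2 * PI * IZR k.
pose k e y := epsilon (inhabits Z0) (Q e y).
have Qk e y : is_edge adj e -> y \notin e -> Q e y (k e y).
  move=> Ee ye; apply: epsilon_spec; apply: ang_arg => t Ht.
  case: (Pc e Ee) => -> _; case: emb => _ /(_ e Ee) [_ [_ [_ H]]]; exact: H.
pose p := vpos eta.
pose S x y m := arg (psub (p y) (p x)) = arg (psub (p x) (p y)) + PI + 2 * PI * IZR m.
pose m x y := epsilon (inhabits Z0) (S x y).
have Sm x y : x != y -> S x y (m x y).
  move=> xy; apply: epsilon_spec; apply: arg_opp => E.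
  by case/eqP: xy; case: emb => inj _; apply: inj.
have PI0 := PI_RGT_0.
exists (fun e y => Z.odd (k e y)), (fun x y => Z.odd (m x y)); split.
  move=> x y xy; have := Sm x y xy; have := Sm y x; rewrite eq_sym => /(_ xy).
  rewrite /S => H1 H2.
  (* Exchanging [x] and [y] twice returns to the same argument, so [m x y + m y x = -1]: exactly one
     of the two is odd. *)
  have : PI * (IZR (m y x) + IZR (m x y) + 1) = 0 by lra.
  case/Rmult_integral; first lra.
  rewrite -!plus_IZR => /eq_IZR H.
  have -> : m y x = Z.add (Z.opp (m x y)) (Zneg xH) by lia.
  by rewrite Z.odd_add Z.odd_opp; case: Z.odd.
move=> e f Ee Ef dis.
have [V1 D1] := Pc e Ee; have [V2 D2] := Pc f Ef.
have [n Hn] := crossing_wind irr prop Ee Ef dis V1 D1 V2 D2.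
have [a [b [ab eE e0 e1]]] := edge_ends irr emb Ee.
have [a' [b' [ab' fE f0 f1]]] := edge_ends irr emb Ef.
have nin x : x \in e -> x \notin f by move=> xe; rewrite (disjointFr dis xe).
have nin' x : x \in f -> x \notin e by move=> xe; rewrite (disjointFl dis xe).
have ae : a \in e by rewrite eE !inE eqxx.
have be : b \in e by rewrite eE !inE eqxx orbT.
have af : a' \in f by rewrite fE !inE eqxx.
have bf : b' \in f by rewrite fE !inE eqxx orbT.
have neq x y : x \in e -> y \in f -> x != y.
  by move=> xe yf; apply: contraTneq xe => ->; apply: nin'.
have Qea := Qk e a' Ee (nin' _ af); have Qeb := Qk e b' Ee (nin' _ bf).
have Qfa := Qk f a Ef (nin _ ae); have Qfb := Qk f b Ef (nin _ be).
have S1 := Sm _ _ (neq _ _ ae af); have S2 := Sm _ _ (neq _ _ ae bf).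
have S3 := Sm _ _ (neq _ _ be af); have S4 := Sm _ _ (neq _ _ be bf).
rewrite /wind !V1 !V2 e0 e1 f0 f1 in Hn.
rewrite /Q !V1 e0 e1 -/p in Qea Qeb.
rewrite /Q !V2 f0 f1 -/p in Qfa Qfb.
rewrite -/p Qea Qeb Qfa Qfb in Hn.
rewrite /S in S1 S2 S3 S4.
have : PI * (IZR (k e a') - IZR (k e b') + IZR (k f b) - IZR (k f a)
    + IZR (m a a') - IZR (m a b') - IZR (m b a') + IZR (m b b')
    - INR (ncross eta e f) - 2 * IZR n) = 0 by lra.
case/Rmult_integral; first lra.
rewrite INR_IZR_INZ -mult_IZR -!(plus_IZR, minus_IZR) => /eq_IZR H.
rewrite -Zodd_nat.
have -> : Z.of_nat (ncross eta e f) = Z.add (Z.add (Z.add (Z.add (Z.add (Z.add (Z.add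
  (Z.add (k e a') (Z.opp (k e b'))) (k f b)) (Z.opp (k f a))) (m a a')) (Z.opp (m a b')))
  (Z.opp (m b a'))) (m b b')) (Z.mul (Zpos (xO xH)) (Z.opp n)) by lia.
rewrite !Z.odd_add !Z.odd_opp Z.odd_mul /=.
rewrite eE fE !big_set2 // -eE -fE /=.
by do 8 case: (Z.odd _).
Qed.

End Winding.

(** * Summation modulo 2 over the pairs of edges of a perfect matching *)

Section Matchings.
Variable V : finType.
Implicit Types (e f : {set V}) (M : {set {set V}}).

Notation "\xor_ ( i | P ) F" := (\big[addb/false]_(i | P) F)
  (at level 41, F at level 41, i at level 50).
Notation "\xor_ ( i 'in' A ) F" := (\big[addb/false]_(i in A) F)
  (at level 41, F at level 41, i, A at level 50).

Definition rank_lt (T : finType) (x y : T) : bool := (enum_rank x < enum_rank y)%N.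

Lemma rank_ltNge (T : finType) (x y : T) : x != y -> rank_lt y x = ~~ rank_lt x y.
Proof.
by move=> xy; rewrite /rank_lt -leqNgt ltn_neqAle val_eqE (inj_eq enum_rank_inj) eq_sym xy.
Qed.

(** For disjoint two-element sets this holds exactly when their ends interleave in the order of
    [enum_rank], that is, when the corresponding chords of a circle cross. *)
Definition chord e f : bool := \xor_(x in e) \xor_(y in f) rank_lt x y.

(* Two tournaments [b] and [rank_lt] have a symmetric sum, and a symmetric function
   of [x], [y] is the sum of its restriction to [rank_lt x y] and the transpose of it. *)
Lemma crossing_chord (adj : rel V) (eta : embedding V) :
  irreflexive adj -> proper_embedding adj eta ->
  exists h : {set V} -> V -> bool, forall e f,
    is_edge adj e -> is_edge adj f -> [disjoint e & f] ->
    odd (ncross eta e f) = chord e f (+) (\xor_(y in f) h e y (+) \xor_(x in e) h f x).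
Proof.
move=> irr prop; have [k [b [bC Hk]]] := crossing_parity irr prop.
pose g x y := rank_lt x y && (b x y (+) rank_lt x y).
exists (fun e y => k e y (+) \xor_(x in e) g x y) => e f Ee Ef dis.
rewrite Hk // !big_split /=.
have -> : \xor_(x in e) \xor_(y in f) b x y = chord e f
    (+) (\xor_(y in f) \xor_(x in e) g x y (+) \xor_(x in e) \xor_(y in f) g y x).
  rewrite [X in _ (+) (X (+) _)]exchange_big -!big_split /=.
  apply: eq_bigr => x xe; rewrite -!big_split /=; apply: eq_bigr => y yf.
  have xy : x != y by apply: contraTneq xe => ->; rewrite (disjointFl dis yf).
  rewrite /g (bC _ _ xy) (rank_ltNge xy).
  by case: (rank_lt _ _); case: (b _ _).
set A := \xor_(y in f) k e y; set B := \xor_(x in e) k f x.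
set C := \xor_(y in f) _; set D := \xor_(x in e) _.
by case: A; case: B; case: C; case: D; case: (chord e f).
Qed.

Lemma matching_block M (adj : rel V) v : perfect_matching adj M ->
  exists e, forall f, (f \in M) && (v \in f) = (f == e).
Proof.
case/andP => _ /forallP /(_ v) /cards1P[e He]; exists e => f.
by have := in_set1 f e; rewrite -He inE.
Qed.

Lemma matching_disjoint (adj : rel V) M e f : perfect_matching adj M ->
  e \in M -> f \in M -> e != f -> [disjoint e & f].
Proof.
move=> pm eM fM; apply: contraR => /pred0Pn[v /andP[/= ve vf]].
have [g Hg] := matching_block v pm.
by rewrite (eqP (etrans (esym (Hg e)) _)) ?eM ?ve // eq_sym -Hg fM vf.
Qed.

(** The correction attached to [e] runs over the vertices of all other edges of [M]. As [M] covers
    each vertex once, these are the vertices outside [e], so the total for [e] does not depend on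
    [M]. *)
Lemma Ccross_parity (adj : rel V) (eta : embedding V) :
  irreflexive adj -> proper_embedding adj eta ->
  exists c : {set V} -> bool, forall M, perfect_matching adj M ->
    odd (Ccross eta M) =
      \xor_(e in M) \xor_(f | (f \in M) && rank_lt e f) chord e f (+) \xor_(e in M) c e.
Proof.
move=> irr prop; have [h Hh] := crossing_chord irr prop.
exists (fun e => \xor_(y | y \notin e) h e y) => M pm.
have edgeM e : e \in M -> is_edge adj e.
  by case/andP: pm => /subsetP sub _ /sub; rewrite inE.
pose G e f := \xor_(y in f) h e y.
have -> : odd (Ccross eta M) = \xor_(e in M) \xor_(f | (f \in M) && rank_lt e f)
    (chord e f (+) (G e f (+) G f e)).
  rewrite /Ccross (big_morph odd oddD (erefl : odd 0 = false)).
  apply: eq_bigr => e eM; rewrite (big_morph odd oddD (erefl : odd 0 = false)).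
  apply: eq_bigr => f /andP[fM ef]; apply: Hh; try exact: edgeM.
  apply: matching_disjoint pm eM fM _.
  by apply: contraTneq ef => ->; rewrite /rank_lt ltnn.
under eq_bigr do rewrite big_split /=.
rewrite big_split /=; congr (_ (+) _).
under eq_bigr do rewrite big_split /=.
rewrite big_split /= [X in _ (+) X](exchange_big_dep (fun f => f \in M)) /=; last first.
  by move=> e f _ /andP[].
rewrite -big_split /=; apply: eq_bigr => e eM.
(* After transposing the second sum, the edges ranked above and below [e] together are all edges of
   [M] other than [e]. *)
transitivity (\xor_(f | (f \in M) && (f != e)) G e f).
  rewrite [RHS](bigID (rank_lt e)) /=; congr (_ (+) _); apply: eq_bigl => f.
    case: (f \in M) => //=; case: eqVneq => // ->.
    by rewrite /rank_lt ltnn.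
  rewrite eM; case: (f \in M) => //=; case: eqVneq => [->|fe].
    by rewrite /rank_lt ltnn.
  by rewrite (rank_ltNge fe) negbK.
(* Each [y] lies in a single edge of [M], so the inner sum has one term; grouping the [y] by that
   edge gives the previous double sum. *)
transitivity (\xor_(y | y \notin e) \xor_(f | (f \in M) && (y \in f)) h e y); last first.
  apply: eq_bigr => y _; have [g Hg] := matching_block y pm.
  by rewrite (eq_bigl _ _ Hg) big_pred1_eq.
rewrite (exchange_big_dep (fun f => f \in M)) /=; last by move=> y f _ /andP[].
rewrite [RHS](bigD1 e) //= [X in X (+) _]big1; last first.
  by move=> y /andP[/negPf -> /andP[]].
apply: eq_bigr => f /andP[fM fe]; apply: eq_bigl => y.
rewrite fM; case: (boolP (y \in f)) => yf; rewrite ?andbF //= andbT.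
by rewrite (disjointFr (matching_disjoint pm fM eM fe) yf).
Qed.

End Matchings.

(** * Absorbing the change of embedding into the edge weights *)

Local Open Scope ring_scope.
Import GRing.Theory.

Theorem theorem2 (V : finType) (adj : rel V) (A : comNzRingType)
  (omega : {set V} -> A) (eta : embedding V) :
  simple_graph adj ->
  (forall e, is_edge adj e -> omega e != 0) ->
  proper_embedding adj eta ->
  forall eta' : embedding V, proper_embedding adj eta' ->
  exists omega' : {set V} -> A,
    sign_modification adj omega omega' /\
    sgf adj omega eta = sgf adj omega' eta'.
Proof.
move=> [_ irr] _ prop eta' prop'.
have [c Hc] := Ccross_parity irr prop; have [c' Hc'] := Ccross_parity irr prop'.
(* The chord sum is common to both embeddings, so the two signs of [M] differ by a product over its
   edges, which goes into the weights. *)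
exists (fun e => (-1) ^+ (c e (+) c' e) * omega e); split.
  by move=> e _; case: (_ (+) _); [right; rewrite mulN1r | left; rewrite mul1r].
apply: eq_bigr => M pm; rewrite big_split /= mulrA; congr (_ * _).
rewrite -(big_morph (fun b : bool => (-1) ^+ b) (@signr_addb A) (expr0 (-1) : (-1) ^+ false = 1)).
rewrite -(signr_odd A (Ccross eta M)) -(signr_odd A (Ccross eta' M)) -signr_addb.
rewrite (Hc M pm) (Hc' M pm) big_split /=.
by do 3 case: (\big[_/_]_(_ in _) _).
Qed.
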